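(* Let $a,b\in R^{WD}$, let $a^{WD}$, $b^{WD}$ be WD inverses of $a$ and $b$ respectively, and let $k=\max\{\mathrm{ind}(a),\mathrm{ind}(b)\}$. If $b^{WD}aa^{WD}=a^{WD}$ and $b^{WD}ba^{WD}=b^{WD}$, then $b^{WD}(a+b)a^{WD}=a^{WD}+b^{WD}$. Furthermore, $b^kaa^{WD}=b^k$, $b^{WD}ba^k=a^k$, $bb^{WD}aa^{WD}=bb^{WD}$ and $b^{WD}ba^{WD}a=a^{WD}a$.
   Context: $R$ is a proper unital ring with involution: an associative ring with $1$ and a map $*:R\to R$ with $(a+b)^*=a^*+b^*$, $(ab)^*=b^*a^*$, $(a^* )^*=a$, such that $a^*a=0$ implies $a=0$. Weak Drazin (WD) inverse: $a\in R$ is WD invertible if there are $x\in R$ and a positive integer $k$ with $axa=a$, $a^{k+1}x=a^k$, $xa^{k+1}=a^k$. The least positive integer $k$ for which such an $x$ exists is the weak Drazin index $\mathrm{ind}(a)$; any $x$ satisfying the three equations with $k=\mathrm{ind}(a)$ is a WD inverse of $a$ (not unique in general), denoted $a^{WD}$. $R^{WD}$ is the set of WD invertible elements. *)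

(* Defs.v *)
From mathcomp Require Import all_boot all_algebra.
From mathcomp Require Import boolp.

Set Implicit Arguments.
Unset Strict Implicit.
Unset Printing Implicit Defensive.

Import GRing.Theory.
Local Open Scope ring_scope.

Record proper_involution (R : pzRingType) (star : R -> R) : Prop :=
  ProperInvolution {
    star_add : forall a b, star (a + b) = star a + star b;
    star_mul : forall a b, star (a * b) = star b * star a;
    star_invol : forall a, star (star a) = a;
    star_proper : forall a, star a * a = 0 -> a = 0 }.

Definition wd_eqs (R : pzRingType) (a : R) (k : nat) (x : R) : Prop :=
  [/\ a * x * a = a, a ^+ k.+1 * x = a ^+ k & x * a ^+ k.+1 = a ^+ k].

Definition wd_exponent (R : pzRingType) (a : R) (k : nat) : Prop :=
  (0 < k)%N /\ exists x, wd_eqs a k x.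

Definition wd_invertible (R : pzRingType) (a : R) : Prop :=
  exists k, wd_exponent a k.

Lemma wd_invertible_asbool (R : pzRingType) (a : R) :
  wd_invertible a -> exists k, `[< wd_exponent a k >].
Proof. by case=> k ak; exists k; apply/asboolP. Qed.

(* Junk value 0 when a is not weak Drazin invertible; all genuine indices are
   positive. *)
Definition wd_index (R : pzRingType) (a : R) : nat :=
  if pselect (wd_invertible a) is left h
  then ex_minn (wd_invertible_asbool h) else 0%N.

(* Weak Drazin inverses need not be unique, so "x is a WD inverse of a" is a
   relation; the exponent is the index itself, not an arbitrary k. *)
Definition wd_inverse (R : pzRingType) (a x : R) : Prop :=
  wd_invertible a /\ wd_eqs a (wd_index a) x.

Lemma wd_indexP (R : pzRingType) (a : R) : wd_invertible a ->
  wd_exponent a (wd_index a) /\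
  forall k, wd_exponent a k -> (wd_index a <= k)%N.
Proof.
rewrite /wd_index; case: pselect => // h _.
case: ex_minnP => m /asboolP am min_m; split=> // k ak.
by apply: min_m; apply/asboolP.
Qed.

(* Main.v *)
Require Import Defs.
From mathcomp Require Import all_boot all_algebra.

Import GRing.Theory.
Local Open Scope ring_scope.

(** The hypotheses reduce to two exchange rules: [b * aWD = b * bWD] (multiply [H2] by [b] on the
    left and use [b * bWD * b = b]) and [bWD * a = aWD * a] (multiply [H1] by [a] on the right). The
    power identities also need both inverses at the common exponent [k], which [wd_eqs_leq]
    provides. *)

Lemma wd_eqs_leq (R : pzRingType) (a : R) (i k : nat) (x : R) :
  (i <= k)%N -> wd_eqs a i x -> wd_eqs a k x.
Proof.
move=> /subnKC <- [axa ax xa]; split=> //.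
- by rewrite addnC -addnS exprD -mulrA ax -exprD.
- by rewrite -addSn exprD mulrA xa -exprD.
Qed.

Theorem theorem3p9 (R : pzRingType) (star : R -> R)
  (Hstar : proper_involution star) (a b aWD bWD : R)
  (Ha : wd_invertible a) (Hb : wd_invertible b)
  (HaWD : wd_inverse a aWD) (HbWD : wd_inverse b bWD)
  (k : nat) (Hk : k = maxn (wd_index a) (wd_index b))
  (H1 : bWD * a * aWD = aWD) (H2 : bWD * b * aWD = bWD) :
  bWD * (a + b) * aWD = aWD + bWD /\
  [/\ b ^+ k * a * aWD = b ^+ k,
      bWD * b * a ^+ k = a ^+ k,
      b * bWD * a * aWD = b * bWD
    & bWD * b * aWD * a = aWD * a].
Proof.
have [axa _ xa] : wd_eqs a k aWD.
  by apply: wd_eqs_leq HaWD.2; rewrite Hk leq_maxl.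
have [byb bY _] : wd_eqs b k bWD.
  by apply: wd_eqs_leq HbWD.2; rewrite Hk leq_maxr.
have bx : b * aWD = b * bWD by rewrite -[in RHS]H2 !mulrA byb.
have ya : bWD * a = aWD * a by rewrite -[in LHS]axa !mulrA H1.
split; first by rewrite mulrDr mulrDl H1 H2.
split.
(* Writing [b ^+ k] as [b ^+ k.+1 * bWD] creates the factor [bWD * a * aWD] of [H1]; [bx] then
   restores [bWD]. *)
- by rewrite -[in LHS]bY -!mulrA (mulrA bWD) H1 exprSr -mulrA bx mulrA -exprSr.
(* Dually, [a ^+ k = aWD * a ^+ k.+1] exposes the left side of [H2], and [ya] restores [aWD]. *)
- by rewrite -[in LHS]xa mulrA H2 exprS mulrA ya -mulrA -exprS.
- by rewrite -!mulrA (mulrA bWD) H1.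
- by rewrite H2.
Qed.
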